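(* Let $x\in(0,\pi/2)$, and write $M_k(t;q)=\left(1-\frac k3+\frac k3 t^{q}\right)^{1/(kq)}$ for $t\in(0,1)$. All pairs $(k,q)$ below are assumed to satisfy ($q\le0$ and $k\ge0$) or ($q\ge0$ and $k\le3$). Consider the double inequality \[ M_k(\cos x;q_1)<\frac{\sin x}{x}<M_k(\cos x;q_2). \tag{$*$} \] (i) If $k\in(3,\infty)$, then $\frac{\sin x}{x}>M_k(\cos x;q)$ holds for $\frac{8}{5(3-k)}\le q\le0$. (ii) If $k\in[\frac{35\pi^2-140}{136},3)$, then $( * )$ holds if $q_2\ge\frac{8}{5(3-k)}$ and $q_1\le1$. (iii) If $k\in[\frac{\pi^2}{4}-1,\frac{35\pi^2-140}{136})$, then $( * )$ holds if $q_2\ge\frac{8}{5(3-k)}$ and either $q_1\le\frac{34}{35}$ or $\frac{\pi^2/4-1}{k}\le q_1\le1$. (iv) If $k\in[\frac75,\frac{\pi^2}{4}-1)$, then $( * )$ holds if $q_2\ge\frac{8}{5(3-k)}$ and $q_1\le\frac{34}{35}$. (v) If $k\in[\frac{23}{17},\frac75)$, then $( * )$ holds if $q_2\ge1$ and $q_1\le\frac{34}{35}$. (vi) If $k\in[0,\frac{23}{17})$, then $( * )$ holds if $q_2\ge1$ and $q_1\le\frac{8}{5(3-k)}$. (vii) If $k\in(-\infty,0)$, then $( * )$ holds if $q_2\ge1$ and $0\le q_1\le\frac{8}{5(3-k)}$.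
   Context: Limit conventions: $M_k(t;q)$ means $\exp\frac{t^q-1}{3q}$ when $k=0\ne q$, and $t^{1/3}$ when $q=0$. *)

(* Defs.v *)
From Stdlib Require Import Reals Lra.
Open Scope R_scope.

(* M_k(t;q) = (1 - k/3 + k/3 t^q)^(1/(kq)), with the limit conventions:
   q = 0 : t^(1/3);   k = 0 <> q : exp((t^q - 1)/(3q)).
   Real powers via Rpower (t > 0, and the base is positive for admissible (k,q)). *)
Definition M (k t q : R) : R :=
  if Req_EM_T q 0 then Rpower t (1/3)
  else if Req_EM_T k 0 then exp ((Rpower t q - 1) / (3 * q))
  else Rpower (1 - k/3 + k/3 * Rpower t q) (1 / (k * q)).

Definition admissible (k q : R) : Prop := (q <= 0 /\ 0 <= k) \/ (0 <= q /\ k <= 3).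

Definition dbl (k q1 q2 x : R) : Prop :=
  M k (cos x) q1 < sin x / x < M k (cos x) q2.

Definition qc (k : R) : R := 8 / (5 * (3 - k)).

(* Main.v *)
Require Import Defs.
From Stdlib Require Import Reals Lra Machin.
From Coquelicot Require Import Coquelicot.
Open Scope R_scope.

(** Writing t = exp (- y), one finds - d/dy ln M_k(t;q) = 1 / (k + (3 - k) exp (q y)), so
    everything reduces to pointwise comparisons of the denominator D_{k,q} = k + (3 - k) t^(-q)
    with the function x sin^2 x / (cos x (sin x - x cos x)), which plays the same role for
    sin x / x.  For k < 3, D increases with q; for q > 0 it decreases with k; and on the
    critical curve q (3 - k) = 8/5 it equals 3 + (8/5) (exp (q y) - 1) / q, which increases
    with q.  Hence only three extremal pairs (k, q) matter: (7/5, 1) for the upper bound, and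
    (29/20, 1) and (23/17, 34/35) for the lower one, where 29/20 <= PI^2/4 - 1.  For D rational
    in c = cos x, the comparison takes the form x < sin x * h(c) or x > sin x * h(c) with h
    rational, and the derivative of x - sin x * h(c) is a rational function of c with an
    evident sign.  For q = 34/35 the power is first replaced by a Pade approximant. *)

(** * Positivity from the sign of a derivative *)

Lemma derive_pos_lt (f f' : R -> R) (a b : R) :
  a < b ->
  (forall x, a <= x <= b -> is_derive f x (f' x)) ->
  (forall x, a < x < b -> 0 < f' x) ->
  f a < f b.
Proof.
intros Hab Hd Hp.
destruct (MVT_cor2 f f' a b Hab) as [c [Hc Hcab]].
{ intros x Hx; apply is_derive_Reals, Hd, Hx. }
specialize (Hp c Hcab); nra.
Qed.

(** If [f (x / 2) < 0], then the increasing [f] stays below that value near 0, against the limit;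
    hence [0 <= f (x / 2) < f x]. A limit stands in for a value because the quotient [sin x / x] is
    singular at 0. *)
Lemma derive_pos_lim0_pos (f f' : R -> R) (b : R) :
  is_lim f 0 0 ->
  (forall x, 0 < x < b -> is_derive f x (f' x)) ->
  (forall x, 0 < x < b -> 0 < f' x) ->
  forall x, 0 < x < b -> 0 < f x.
Proof.
intros Hl Hd Hp x Hx.
assert (Hinc : forall u v, 0 < u -> u < v -> v < b -> f u < f v).
{ intros u v Hu Huv Hv; apply (derive_pos_lt f f'); trivial.
  - intros z Hz; apply Hd; lra.
  - intros z Hz; apply Hp; lra. }
assert (Hhalf : f (x / 2) < f x) by (apply Hinc; lra).
destruct (Rlt_le_dec (f (x / 2)) 0) as [Hneg | ]; [exfalso | lra].
apply is_lim_spec in Hl.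
assert (Heps : 0 < - f (x / 2)) by lra.
destruct (Hl (mkposreal _ Heps)) as [d Hball]; simpl in Hball.
pose proof (cond_pos d).
set (u := Rmin (d / 2) (x / 4)).
assert (Hu : 0 < u) by (apply Rmin_pos; lra).
assert (Hud : u <= d / 2) by apply Rmin_l.
assert (Hux : u <= x / 4) by apply Rmin_r.
assert (Hfu : f u < f (x / 2)) by (apply Hinc; lra).
assert (Hb : Rabs (f u - 0) < - f (x / 2)).
{ apply Hball; [ | lra].
  change (Rabs (u - 0) < d); rewrite Rabs_pos_eq; lra. }
rewrite Rabs_left in Hb; lra.
Qed.

(** * The denominator of the logarithmic derivative of [M] *)

(* At t = exp (- y), this is the denominator k + (3 - k) exp (q y). *)
Definition Mden (k q t : R) : R := k + (3 - k) * Rpower t (- q).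

Lemma Rpower_le_1 (t q : R) : 0 < t <= 1 -> 0 <= q -> Rpower t q <= 1.
Proof.
intros Ht Hq; rewrite <- exp_0; unfold Rpower.
assert (ln t <= 0) by (rewrite <- ln_1; apply ln_le; lra).
destruct (Rle_lt_or_eq_dec (q * ln t) 0) as [H1 | H1].
- nra.
- left; apply exp_increasing, H1.
- rewrite H1; lra.
Qed.

Lemma Rpower_gt0 (t q : R) : 0 < Rpower t q.
Proof. apply exp_pos. Qed.

(** With [p = t^(-q)], the denominator is [k (1 - p) + 3 p], where [p <= 1] if [q <= 0]. If
    [q >= 0], then [p >= 1] and the value is at least 3. *)
Lemma Mden_pos (k q t : R) : admissible k q -> 0 < t <= 1 -> 0 < Mden k q t.
Proof.
intros Hadm Ht; unfold Mden.
pose proof (Rpower_gt0 t (- q)) as Hp.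
destruct Hadm as [[Hq Hk] | [Hq Hk]].
- assert (Rpower t (- q) <= 1) by (apply Rpower_le_1; lra).
  destruct (Rle_lt_dec k 3); nra.
- assert (Hle : Rpower t q <= 1) by (apply Rpower_le_1; lra).
  assert (Hinv : Rpower t q * Rpower t (- q) = 1).
  { rewrite <- Rpower_plus, Rplus_opp_r; apply Rpower_O; lra. }
  pose proof (Rpower_gt0 t q).
  assert (1 <= Rpower t (- q)) by nra.
  nra.
Qed.

Lemma M_pos (k t q : R) : 0 < M k t q.
Proof.
unfold M; destruct (Req_EM_T q 0); [apply exp_pos | ].
destruct (Req_EM_T k 0); apply exp_pos.
Qed.

Lemma M_at_1 (k q : R) : M k 1 q = 1.
Proof.
assert (H1 : forall p, Rpower 1 p = 1).
{ intros p; unfold Rpower; rewrite ln_1, Rmult_0_r; apply exp_0. }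
unfold M; destruct (Req_EM_T q 0); [apply H1 | ].
destruct (Req_EM_T k 0); rewrite H1.
- rewrite <- exp_0; f_equal; field; trivial.
- replace (1 - k / 3 + k / 3 * 1) with 1 by field; apply H1.
Qed.

(** The base of the power in [M] equals [t^q / 3] times [Mden k q t], so it is positive, and the
    limit conventions give the same formula for the derivative. *)
Lemma is_derive_ln_M (k q t : R) :
  admissible k q -> 0 < t <= 1 ->
  is_derive (fun u => ln (M k u q)) t (/ (t * Mden k q t)).
Proof.
intros Hadm Ht.
pose proof (Mden_pos k q t Hadm Ht) as Hden; unfold Mden in *.
unfold M; destruct (Req_EM_T q 0) as [-> | Hq].
- apply (is_derive_ext (fun u => 1 / 3 * ln u)).
  { intros u; unfold Rpower; now rewrite ln_exp. }
  rewrite Ropp_0, Rpower_O by lra.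
  auto_derive; [lra | field; lra].
- assert (Hpow : Rpower t (- q) = / Rpower t q) by apply Rpower_Ropp.
  pose proof (Rpower_gt0 t q) as Hp.
  destruct (Req_EM_T k 0) as [-> | Hk].
  + apply (is_derive_ext (fun u => (Rpower u q - 1) / (3 * q))).
    { intros u; now rewrite ln_exp. }
    rewrite Hpow; unfold Rpower in *.
    auto_derive; [lra | field; lra].
  + assert (Hbase : 0 < 1 - k / 3 + k / 3 * Rpower t q).
    { replace (1 - k / 3 + k / 3 * Rpower t q)
        with (Rpower t q / 3 * (k + (3 - k) * Rpower t (- q)))
        by (rewrite Hpow; field; lra).
      apply Rmult_lt_0_compat; lra. }
    apply (is_derive_ext
      (fun u => 1 / (k * q) * ln (1 - k / 3 + k / 3 * Rpower u q))).
    { intros u; unfold Rpower at 2; now rewrite ln_exp. }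
    assert (Hne : k * Rpower t q + (3 - k) <> 0) by lra.
    rewrite Hpow in *; unfold Rpower in *.
    auto_derive; [lra | field; repeat split; lra].
Qed.

(** * Reduction to an inequality between denominators *)

Lemma sin_cos_pos (x : R) :
  0 < x < PI / 2 -> 0 < sin x /\ 0 < cos x < 1.
Proof.
intros Hx; split; [apply sin_gt_0; lra | split].
- apply cos_gt_0; lra.
- rewrite <- cos_0; apply cos_decreasing_1; lra.
Qed.

Lemma is_derive_ln_sinc_M (k q x : R) :
  admissible k q -> 0 < x < PI / 2 ->
  is_derive (fun u => ln (sin u / u) - ln (M k (cos u) q)) x
    (cos x / sin x - / x + sin x / (cos x * Mden k q (cos x))).
Proof.
intros Hadm Hx; destruct (sin_cos_pos x Hx) as [Hs [Hc Hc1]].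
assert (Hden : 0 < Mden k q (cos x)) by (apply Mden_pos; trivial; lra).
replace (cos x / sin x - / x + sin x / (cos x * Mden k q (cos x)))
  with (minus (cos x / sin x - / x) (scal (- sin x) (/ (cos x * Mden k q (cos x))))).
2: { unfold minus, scal, plus, opp; simpl; unfold mult; simpl; field; lra. }
apply (is_derive_minus (fun u => ln (sin u / u)) (fun u => ln (M k (cos u) q))).
- assert (0 < sin x * / x) by (apply Rdiv_lt_0_compat; lra).
  auto_derive; [lra | field; lra].
- apply (is_derive_comp (fun t => ln (M k t q)) cos).
  + apply is_derive_ln_M; trivial; lra.
  + apply is_derive_Reals, derivable_pt_lim_cos.
Qed.

(** Both [sin u / u] and [M k (cos u) q] tend to 1. For the latter, continuity comes from the
    differentiability of [ln (M k t q)] at the endpoint [t = 1]. *)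
Lemma is_lim_ln_sinc_M (k q : R) :
  admissible k q -> is_lim (fun u => ln (sin u / u) - ln (M k (cos u) q)) 0 0.
Proof.
intros Hadm.
apply (is_lim_minus _ _ _ 0 0).
- assert (Hcont : continuous ln 1).
  { apply (ex_derive_continuous (V := R_NormedModule)); auto_derive; lra. }
  pose proof (is_lim_comp_continuous _ ln 0 1 is_lim_sinc_0 Hcont) as Hlim.
  rewrite ln_1 in Hlim; exact Hlim.
- assert (Hlim : is_lim (fun u => ln (M k (cos u) q)) 0 (ln (M k (cos 0) q))).
  2: rewrite cos_0, M_at_1, ln_1 in Hlim; exact Hlim.
  apply (is_lim_continuity (fun u => ln (M k (cos u) q)) 0).
  apply continuity_pt_filterlim.
  apply (ex_derive_continuous (V := R_NormedModule)
    (fun u => ln (M k (cos u) q)) 0).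
  apply (ex_derive_comp (fun t => ln (M k t q)) cos).
  + rewrite cos_0; eexists; apply is_derive_ln_M; trivial; lra.
  + auto_derive; trivial.
- unfold is_Rbar_minus, is_Rbar_plus; simpl; do 2 f_equal; lra.
Qed.

Lemma ln_sinc_M_derive_eq (k q x : R) :
  admissible k q -> 0 < x < PI / 2 ->
  cos x / sin x - / x + sin x / (cos x * Mden k q (cos x)) =
  (x * sin x ^ 2 - cos x * Mden k q (cos x) * (sin x - x * cos x))
   / (x * sin x * (cos x * Mden k q (cos x))).
Proof.
intros Hadm Hx; destruct (sin_cos_pos x Hx) as [Hs [Hc Hc1]].
assert (Hden : 0 < Mden k q (cos x)) by (apply Mden_pos; trivial; lra).
field; lra.
Qed.

(** The assumed inequality is the positivity of the numerator in [ln_sinc_M_derive_eq]; the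
    logarithm of the ratio then increases from its limit 0. *)
Lemma M_lt_sinc (k q : R) :
  admissible k q ->
  (forall x, 0 < x < PI / 2 ->
     cos x * Mden k q (cos x) * (sin x - x * cos x) < x * sin x ^ 2) ->
  forall x, 0 < x < PI / 2 -> M k (cos x) q < sin x / x.
Proof.
intros Hadm Hlt x Hx.
assert (Hpos : 0 < ln (sin x / x) - ln (M k (cos x) q)).
{ revert x Hx; eapply derive_pos_lim0_pos.
  - now apply is_lim_ln_sinc_M.
  - intros x Hx; now apply is_derive_ln_sinc_M.
  - intros x Hx; destruct (sin_cos_pos x Hx) as [Hs [Hc Hc1]]; simpl.
    assert (Hden : 0 < Mden k q (cos x)) by (apply Mden_pos; trivial; lra).
    rewrite ln_sinc_M_derive_eq by trivial.
    specialize (Hlt x Hx).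
    apply Rdiv_lt_0_compat; [lra | ].
    repeat apply Rmult_lt_0_compat; lra. }
destruct (sin_cos_pos x Hx) as [Hs _].
apply ln_lt_inv; [apply M_pos | apply Rdiv_lt_0_compat; lra | lra].
Qed.

Lemma sinc_lt_M (k q : R) :
  admissible k q ->
  (forall x, 0 < x < PI / 2 ->
     x * sin x ^ 2 < cos x * Mden k q (cos x) * (sin x - x * cos x)) ->
  forall x, 0 < x < PI / 2 -> sin x / x < M k (cos x) q.
Proof.
intros Hadm Hlt x Hx.
assert (Hpos : 0 < - (ln (sin x / x) - ln (M k (cos x) q))).
{ revert x Hx; eapply derive_pos_lim0_pos.
  - pose proof (is_lim_opp _ 0 0 (is_lim_ln_sinc_M k q Hadm)) as Hlim.
    simpl in Hlim; rewrite Ropp_0 in Hlim; exact Hlim.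
  - intros x Hx; apply (is_derive_opp (V := R_NormedModule));
    now apply is_derive_ln_sinc_M.
  - intros x Hx; destruct (sin_cos_pos x Hx) as [Hs [Hc Hc1]].
    assert (Hden : 0 < Mden k q (cos x)) by (apply Mden_pos; trivial; lra).
    unfold opp; simpl; rewrite ln_sinc_M_derive_eq by trivial.
    specialize (Hlt x Hx).
    rewrite <- Rdiv_opp_l; apply Rdiv_lt_0_compat; [lra | ].
    repeat apply Rmult_lt_0_compat; lra. }
destruct (sin_cos_pos x Hx) as [Hs _].
apply ln_lt_inv; [apply Rdiv_lt_0_compat; lra | apply M_pos | lra].
Qed.

(** * Monotonicity of the denominator in [q], in [k] and along the critical curve *)

Lemma Rpower_opp_le (t q1 q2 : R) :
  0 < t <= 1 -> q1 <= q2 -> Rpower t (- q1) <= Rpower t (- q2).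
Proof.
intros Ht Hq.
replace (- q1) with (- q2 + (q2 - q1)) by lra; rewrite Rpower_plus.
assert (Rpower t (q2 - q1) <= 1) by (apply Rpower_le_1; lra).
pose proof (Rpower_gt0 t (- q2)); nra.
Qed.

Lemma Mden_le_q (k q1 q2 t : R) :
  0 < t <= 1 -> k <= 3 -> q1 <= q2 -> Mden k q1 t <= Mden k q2 t.
Proof.
intros Ht Hk Hq; unfold Mden.
pose proof (Rpower_opp_le t q1 q2 Ht Hq); nra.
Qed.

Lemma Mden_ge_q (k q1 q2 t : R) :
  0 < t <= 1 -> 3 <= k -> q1 <= q2 -> Mden k q2 t <= Mden k q1 t.
Proof.
intros Ht Hk Hq; unfold Mden.
pose proof (Rpower_opp_le t q1 q2 Ht Hq); nra.
Qed.

Lemma Mden_ge_k (k1 k2 q t : R) :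
  0 < t <= 1 -> 0 <= q -> k1 <= k2 -> Mden k2 q t <= Mden k1 q t.
Proof.
intros Ht Hq Hk; unfold Mden.
pose proof (Rpower_opp_le t 0 q Ht Hq) as Hle.
rewrite Ropp_0, Rpower_O in Hle by lra; nra.
Qed.

(** The quotient is the integral of [exp (a z)] over [[0, y]], which increases with [a]. Negative
    [a] is allowed because [qc k < 0] for [k > 3]; there [y] separates the two sides. *)
Lemma expm1_div_le (a b y : R) :
  0 <= y -> a <> 0 -> 0 < b -> a <= b ->
  (exp (a * y) - 1) / a <= (exp (b * y) - 1) / b.
Proof.
intros Hy Ha Hb Hab.
destruct (Rlt_le_dec a 0) as [Hneg | Hpos].
- apply Rle_trans with y.
  + pose proof (exp_ineq1_le (a * y)).
    apply Rmult_le_reg_r with (- a); [lra | ].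
    replace ((exp (a * y) - 1) / a * - a) with (1 - exp (a * y)) by (field; lra).
    lra.
  + pose proof (exp_ineq1_le (b * y)).
    apply Rmult_le_reg_r with b; [lra | ].
    replace ((exp (b * y) - 1) / b * b) with (exp (b * y) - 1) by (field; lra).
    lra.
- destruct (Rle_lt_or_eq_dec _ _ Hab) as [Hlt | ->]; [ | lra].
  destruct (Rle_lt_or_eq_dec _ _ Hy) as [Hy0 | <-].
  2: rewrite !Rmult_0_r, exp_0; lra.
  enough ((exp (b * 0) - 1) / b - (exp (a * 0) - 1) / a <
          (exp (b * y) - 1) / b - (exp (a * y) - 1) / a) as H.
  { rewrite !Rmult_0_r, exp_0 in H; lra. }
  apply (derive_pos_lt (fun z => (exp (b * z) - 1) / b - (exp (a * z) - 1) / a)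
    (fun z => exp (b * z) - exp (a * z))); trivial.
  + intros z _; auto_derive; [trivial | field; lra].
  + intros z Hz.
    assert (exp (a * z) < exp (b * z)) by (apply exp_increasing; nra).
    lra.
Qed.

(* On the critical curve 3 - k = 8 / (5 q), so k = 3 - 8 / (5 q). *)
Lemma Mden_qc (k t : R) :
  k <> 3 -> Mden k (qc k) t = 3 + 8 / 5 * ((exp (qc k * - ln t) - 1) / qc k).
Proof.
intros Hk; unfold Mden, Rpower.
replace (- qc k * ln t) with (qc k * - ln t) by ring.
set (e := exp _); unfold qc; field; lra.
Qed.

Lemma Mden_qc_le (k k' t : R) :
  0 < t <= 1 -> k <> 3 -> k' < 3 -> qc k <= qc k' ->
  Mden k (qc k) t <= Mden k' (qc k') t.
Proof.
intros Ht Hk Hk' Hle; rewrite !Mden_qc by lra.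
apply Rplus_le_compat_l, Rmult_le_compat_l; [lra | ].
apply expm1_div_le; trivial.
- assert (ln t <= 0) by (rewrite <- ln_1; apply ln_le; lra); lra.
- unfold qc; apply Rmult_integral_contrapositive_currified; [lra | ].
  apply Rinv_neq_0_compat; lra.
- unfold qc; apply Rdiv_lt_0_compat; lra.
Qed.

(** No sign of [s - x * c] is presupposed: if it is nonpositive, so is the left side of the
    conclusion. *)
Lemma Mden_lt_of_le (x s c D D' : R) :
  0 < x -> 0 < s -> 0 < c -> 0 < D -> D <= D' ->
  c * D' * (s - x * c) < x * s ^ 2 -> c * D * (s - x * c) < x * s ^ 2.
Proof.
intros Hx Hs Hc HD HDD Hlt.
assert (0 < x * s ^ 2) by (apply Rmult_lt_0_compat; [lra | apply pow_lt; lra]).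
destruct (Rle_lt_dec (s - x * c) 0) as [Hn | Hp].
- assert (0 < c * D) by (apply Rmult_lt_0_compat; lra); nra.
- apply Rle_lt_trans with (2 := Hlt).
  apply Rmult_le_compat_r; [lra | apply Rmult_le_compat_l; lra].
Qed.

(** Here the assumed inequality itself forces [s - x * c] to be positive. *)
Lemma Mden_gt_of_ge (x s c D D' : R) :
  0 < x -> 0 < s -> 0 < c -> 0 < D -> D <= D' ->
  x * s ^ 2 < c * D * (s - x * c) -> x * s ^ 2 < c * D' * (s - x * c).
Proof.
intros Hx Hs Hc HD HDD Hlt.
assert (0 < x * s ^ 2) by (apply Rmult_lt_0_compat; [lra | apply pow_lt; lra]).
assert (0 < c * D) by (apply Rmult_lt_0_compat; lra).
assert (0 < s - x * c) by nra.
apply Rlt_le_trans with (1 := Hlt).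
apply Rmult_le_compat_r; [lra | apply Rmult_le_compat_l; lra].
Qed.

(** * The extremal pairs with [q = 1] *)

Lemma cos_Mden_1 (k c : R) : 0 < c -> c * Mden k 1 c = k * c + 3 - k.
Proof.
intros Hc; unfold Mden; rewrite Rpower_Ropp, Rpower_1 by trivial; field; lra.
Qed.

Lemma sin_sq_cos (x : R) : sin x ^ 2 = 1 - cos x ^ 2.
Proof. pose proof (sin2_cos2 x) as H; unfold Rsqr in H; nra. Qed.

(** Solving the equality case of the comparison for [x] gives the subtracted quotient: [den] is
    [sin x ^ 2 + c * (k * c + 3 - k)]. *)
Lemma is_derive_Mden_1_gap (k x : R) :
  let c := cos x in
  let den := 1 + (3 - k) * c + (k - 1) * c ^ 2 in
  den <> 0 ->
  is_derive (fun u => u - sin u * (k * cos u + 3 - k)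
                          / (1 + (3 - k) * cos u + (k - 1) * cos u ^ 2)) x
    ((1 - c) ^ 2 * (1 + c) * ((7 * k - k ^ 2 - 8) + (k - 1) ^ 2 * c) / den ^ 2).
Proof.
intros c den Hden.
auto_derive; [fold c; fold den; intuition | ].
fold c.
(* Keeping [sin x ^ 2] as one factor leaves a rational identity in [c] once it is rewritten as
   [1 - c ^ 2]. *)
transitivity ((den ^ 2 - c * (k * c + 3 - k) * den +
   sin x ^ 2 * (k * den - (k * c + 3 - k) * (3 - k + 2 * (k - 1) * c))) / den ^ 2).
- unfold den in *; field; trivial.
- rewrite sin_sq_cos; fold c; unfold den in *; field; trivial.
Qed.

Lemma Mden_7_5_gt (x : R) :
  0 < x < PI / 2 ->
  x * sin x ^ 2 < cos x * Mden (7 / 5) 1 (cos x) * (sin x - x * cos x).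
Proof.
intros Hx; destruct (sin_cos_pos x Hx) as [Hs [Hc Hc1]].
rewrite cos_Mden_1, sin_sq_cos by trivial.
set (den u := 1 + (3 - 7 / 5) * cos u + (7 / 5 - 1) * cos u ^ 2).
assert (Hgap : - (0 - sin 0 * (7 / 5 * cos 0 + 3 - 7 / 5) / den 0) <
               - (x - sin x * (7 / 5 * cos x + 3 - 7 / 5) / den x)).
{ eapply (derive_pos_lt
    (fun u => - (u - sin u * (7 / 5 * cos u + 3 - 7 / 5) / den u))); [lra | | ].
  - intros u Hu; apply (is_derive_opp (V := R_NormedModule)).
    apply is_derive_Mden_1_gap.
    assert (0 < cos u) by (apply cos_gt_0; lra); nra.
  - intros u Hu; destruct (sin_cos_pos u) as [_ [Hcu Hcu1]]; [lra | ].
    unfold opp; simpl Ropp; rewrite <- Rdiv_opp_l.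
    apply Rdiv_lt_0_compat; [ | apply pow_lt; nra].
    (* At [c = 1] the last factor of the derivative is [5 k - 7]; it vanishes for [k = 7/5], which
       yields a third factor [1 - cos u]. *)
    replace (- _) with (4 / 25 * ((1 - cos u) ^ 3 * (1 + cos u))) by field.
    apply Rmult_lt_0_compat; [lra | ].
    apply Rmult_lt_0_compat; [apply pow_lt; lra | lra]. }
rewrite sin_0 in Hgap.
assert (Hden : 0 < den x) by (unfold den; nra).
assert (Hlt : x < sin x * (7 / 5 * cos x + 3 - 7 / 5) / den x) by lra.
apply (Rmult_lt_compat_r (den x)) in Hlt; trivial.
replace (sin x * (7 / 5 * cos x + 3 - 7 / 5) / den x * den x)
  with (sin x * (7 / 5 * cos x + 3 - 7 / 5)) in Hlt by (field; lra).
unfold den in Hlt; lra.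
Qed.

(** The number 29/20 lies above the smaller root 1.438... of [7 k - k^2 - 8], so both coefficients
    in the derivative are positive, and below [PI^2/4 - 1 = 1.467...]. *)
Lemma Mden_29_20_lt (x : R) :
  0 < x < PI / 2 ->
  cos x * Mden (29 / 20) 1 (cos x) * (sin x - x * cos x) < x * sin x ^ 2.
Proof.
intros Hx; destruct (sin_cos_pos x Hx) as [Hs [Hc Hc1]].
rewrite cos_Mden_1, sin_sq_cos by trivial.
set (den u := 1 + (3 - 29 / 20) * cos u + (29 / 20 - 1) * cos u ^ 2).
assert (Hgap : 0 - sin 0 * (29 / 20 * cos 0 + 3 - 29 / 20) / den 0 <
               x - sin x * (29 / 20 * cos x + 3 - 29 / 20) / den x).
{ eapply (derive_pos_lt
    (fun u => u - sin u * (29 / 20 * cos u + 3 - 29 / 20) / den u)); [lra | | ].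
  - intros u Hu; apply is_derive_Mden_1_gap.
    assert (0 < cos u) by (apply cos_gt_0; lra); nra.
  - intros u Hu; destruct (sin_cos_pos u) as [_ [Hcu Hcu1]]; [lra | ].
    apply Rdiv_lt_0_compat; [ | apply pow_lt; nra].
    apply Rmult_lt_0_compat; [ | lra].
    apply Rmult_lt_0_compat; [apply pow_lt; lra | lra]. }
rewrite sin_0 in Hgap.
assert (Hden : 0 < den x) by (unfold den; nra).
assert (Hlt : sin x * (29 / 20 * cos x + 3 - 29 / 20) / den x < x) by lra.
apply (Rmult_lt_compat_r (den x)) in Hlt; trivial.
replace (sin x * (29 / 20 * cos x + 3 - 29 / 20) / den x * den x)
  with (sin x * (29 / 20 * cos x + 3 - 29 / 20)) in Hlt by (field; lra).
unfold den in Hlt; lra.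
Qed.

(** * The extremal pair [(23/17, 34/35)] *)

(* The right-hand side is the [2/1] Pade approximant of w^(34/35) at w = 1. *)
Lemma Rpower_34_35_le (w : R) :
  1 <= w ->
  Rpower w (34 / 35) <=
    (1225 + 1610 * (w - 1) + 391 * (w - 1) ^ 2) / (1225 + 420 * (w - 1)).
Proof.
intros Hw.
set (U v := 1225 + 1610 * (v - 1) + 391 * (v - 1) ^ 2).
set (V v := 1225 + 420 * (v - 1)).
assert (HU : forall v, 1 <= v -> 0 < U v) by (intros v Hv; unfold U; nra).
assert (HV : forall v, 1 <= v -> 0 < V v) by (intros v Hv; unfold V; nra).
fold (U w) (V w).
enough (34 / 35 * ln w <= ln (U w) - ln (V w)) as Hln.
{ rewrite <- (exp_ln (U w / V w)), ln_div by (try apply Rdiv_lt_0_compat; auto).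
  unfold Rpower; destruct (Rle_lt_or_eq_dec _ _ Hln) as [H | ->]; [ | lra].
  left; now apply exp_increasing. }
assert (HUV1 : U 1 = V 1) by (unfold U, V; ring).
destruct (Rle_lt_or_eq_dec _ _ Hw) as [Hw1 | <-].
2: { rewrite HUV1, ln_1; lra. }
enough (ln (U 1) - ln (V 1) - 34 / 35 * ln 1 < ln (U w) - ln (V w) - 34 / 35 * ln w) as H.
{ rewrite HUV1, ln_1 in H; lra. }
apply (derive_pos_lt (fun v => ln (U v) - ln (V v) - 34 / 35 * ln v)
  (fun v => ((1610 + 782 * (v - 1)) * V v - 420 * U v) / (U v * V v) - 34 / 35 / v));
  trivial.
- intros v Hv.
  assert (0 < U v) by (apply HU; lra).
  assert (0 < V v) by (apply HV; lra).
  unfold U, V in *.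
  auto_derive; [repeat split; lra | field; repeat split; lra].
- intros v Hv.
  assert (0 < U v) by (apply HU; lra).
  assert (0 < V v) by (apply HV; lra).
  assert (0 < v * (U v * V v)) by (repeat apply Rmult_lt_0_compat; lra).
  (* The approximant agrees with the power to third order at 1, so the logarithmic derivatives
     differ by a multiple of [(v - 1)^3]. *)
  replace (((1610 + 782 * (v - 1)) * V v - 420 * U v) / (U v * V v) - 34 / 35 / v)
    with (4692 * (v - 1) ^ 3 / (v * (U v * V v))).
  + apply Rdiv_lt_0_compat; trivial.
    apply Rmult_lt_0_compat; [lra | apply pow_lt; lra].
  + unfold U, V in *; field; repeat split; lra.
Qed.

Lemma Mden_23_17_le (t : R) :
  0 < t <= 1 ->
  Mden (23 / 17) (34 / 35) t <= (92 + 276 * t + 157 * t ^ 2) / (60 + 115 * t) / t.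
Proof.
intros Ht; unfold Mden.
assert (Hinv : 1 <= / t).
{ rewrite <- Rinv_1; apply Rinv_le_contravar; lra. }
assert (Hpow : Rpower t (- (34 / 35)) = Rpower (/ t) (34 / 35)).
{ unfold Rpower; rewrite ln_Rinv by lra; f_equal; ring. }
rewrite Hpow.
pose proof (Rpower_34_35_le (/ t) Hinv) as Hle.
apply Rle_trans with (23 / 17 + (3 - 23 / 17) *
  ((1225 + 1610 * (/ t - 1) + 391 * (/ t - 1) ^ 2) / (1225 + 420 * (/ t - 1)))).
- apply Rplus_le_compat_l, Rmult_le_compat_l; lra.
- right; field; repeat split; lra.
Qed.

(** On the critical curve, [q = 34/35] makes the two denominators agree to second order at [c = 1],
    whence the factor [(1 - cos u)^4] in the derivative below. *)
Lemma Mden_23_17_lt (x : R) :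
  0 < x < PI / 2 ->
  cos x * Mden (23 / 17) (34 / 35) (cos x) * (sin x - x * cos x) < x * sin x ^ 2.
Proof.
intros Hx; destruct (sin_cos_pos x Hx) as [Hs [Hc Hc1]].
set (P c := 92 + 276 * c + 157 * c ^ 2).
(* [W c] is [(1 - c^2) (60 + 115 c) + c P(c)], the coefficient of [x] after clearing
   denominators. *)
set (W c := 60 + 207 * c + 216 * c ^ 2 + 42 * c ^ 3).
assert (HW : forall c, 0 < c -> 0 < W c).
{ intros c H; unfold W; pose proof (pow_lt c 3 H); nra. }
apply (Mden_lt_of_le x (sin x) (cos x) _ (P (cos x) / (60 + 115 * cos x) / cos x));
  try lra.
{ apply Mden_pos; [right | ]; lra. }
{ apply Mden_23_17_le; lra. }
assert (Hgap : 0 - sin 0 * P (cos 0) / W (cos 0) <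
               x - sin x * P (cos x) / W (cos x)).
{ apply (derive_pos_lt (fun u => u - sin u * P (cos u) / W (cos u))
    (fun u => 36 * (1 - cos u) ^ 4 * (1 + cos u) * (31 + 49 * cos u)
              / W (cos u) ^ 2)); [lra | | ].
  - intros u Hu.
    assert (Hcu : 0 < cos u) by (apply cos_gt_0; lra).
    assert (HWu := HW _ Hcu).
    unfold P, W in HWu |- *; auto_derive; [lra | ].
    transitivity ((W (cos u) ^ 2 - cos u * P (cos u) * W (cos u) + sin u ^ 2 *
      ((276 + 314 * cos u) * W (cos u)
        - P (cos u) * (207 + 432 * cos u + 126 * cos u ^ 2))) / W (cos u) ^ 2).
    + unfold P, W; field; lra.
    + rewrite sin_sq_cos; unfold P, W; field; lra.
  - intros u Hu; destruct (sin_cos_pos u) as [_ [Hcu Hcu1]]; [lra | ].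
    apply Rdiv_lt_0_compat; [ | apply pow_lt; auto].
    repeat apply Rmult_lt_0_compat; try lra; apply pow_lt; lra. }
rewrite sin_0 in Hgap.
assert (HWx := HW _ Hc).
assert (Hlt : sin x * P (cos x) / W (cos x) < x) by lra.
apply (Rmult_lt_compat_r (W (cos x))) in Hlt; trivial.
replace (sin x * P (cos x) / W (cos x) * W (cos x))
  with (sin x * P (cos x)) in Hlt by (field; lra).
apply Rmult_lt_reg_r with (60 + 115 * cos x); [lra | ].
replace (cos x * (P (cos x) / (60 + 115 * cos x) / cos x) *
         (sin x - x * cos x) * (60 + 115 * cos x))
  with (P (cos x) * (sin x - x * cos x)) by (field; lra).
rewrite sin_sq_cos; unfold P, W in *; nra.
Qed.

(** * Paths from a general pair to an extremal one *)

Lemma M_lt_sinc_of_Mden_le (k q k' q' : R) :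
  admissible k q ->
  (forall x, 0 < x < PI / 2 ->
     cos x * Mden k' q' (cos x) * (sin x - x * cos x) < x * sin x ^ 2) ->
  (forall t, 0 < t <= 1 -> Mden k q t <= Mden k' q' t) ->
  forall x, 0 < x < PI / 2 -> M k (cos x) q < sin x / x.
Proof.
intros Hadm Hlt Hle; apply M_lt_sinc; trivial.
intros x Hx; destruct (sin_cos_pos x Hx) as [Hs Hc].
apply (Mden_lt_of_le x (sin x) (cos x) _ (Mden k' q' (cos x))); try lra.
- apply Mden_pos; trivial; lra.
- apply Hle; lra.
- now apply Hlt.
Qed.

Lemma sinc_lt_M_of_Mden_ge (k q : R) :
  admissible k q ->
  (forall t, 0 < t <= 1 -> Mden (7 / 5) 1 t <= Mden k q t) ->
  forall x, 0 < x < PI / 2 -> sin x / x < M k (cos x) q.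
Proof.
intros Hadm Hge; apply sinc_lt_M; trivial.
intros x Hx; destruct (sin_cos_pos x Hx) as [Hs Hc].
apply (Mden_gt_of_ge x (sin x) (cos x) (Mden (7 / 5) 1 (cos x))); try lra.
- apply Mden_pos; [right | ]; lra.
- apply Hge; lra.
- now apply Mden_7_5_gt.
Qed.

Lemma qc_increasing (k k' : R) : k <= k' -> k' < 3 -> qc k <= qc k'.
Proof.
intros Hk Hk'; unfold qc, Rdiv.
apply Rmult_le_compat_l; [lra | apply Rinv_le_contravar; lra].
Qed.

Lemma qc_7_5 : qc (7 / 5) = 1.
Proof. unfold qc; field. Qed.

Lemma qc_23_17 : qc (23 / 17) = 34 / 35.
Proof. unfold qc; field. Qed.

(** From [(7/5, 1)], follow the critical curve to [(k, qc k)], then raise [q]. *)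
Lemma sinc_lt_M_large_k (k q : R) :
  7 / 5 <= k < 3 -> admissible k q -> qc k <= q ->
  forall x, 0 < x < PI / 2 -> sin x / x < M k (cos x) q.
Proof.
intros Hk Hadm Hq; apply sinc_lt_M_of_Mden_ge; trivial; intros t Ht.
rewrite <- qc_7_5; apply Rle_trans with (Mden k (qc k) t).
- apply Mden_qc_le; try lra; apply qc_increasing; lra.
- apply Mden_le_q; lra.
Qed.

Lemma sinc_lt_M_small_k (k q : R) :
  k <= 7 / 5 -> admissible k q -> 1 <= q ->
  forall x, 0 < x < PI / 2 -> sin x / x < M k (cos x) q.
Proof.
intros Hk Hadm Hq; apply sinc_lt_M_of_Mden_ge; trivial; intros t Ht.
apply Rle_trans with (Mden k 1 t).
- apply Mden_ge_k; lra.
- apply Mden_le_q; lra.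
Qed.

Lemma M_lt_sinc_k_ge (k q : R) :
  29 / 20 <= k <= 3 -> admissible k q -> q <= 1 ->
  forall x, 0 < x < PI / 2 -> M k (cos x) q < sin x / x.
Proof.
intros Hk Hadm Hq.
apply (M_lt_sinc_of_Mden_le _ _ (29 / 20) 1 Hadm Mden_29_20_lt); intros t Ht.
apply Rle_trans with (Mden k 1 t).
- apply Mden_le_q; lra.
- apply Mden_ge_k; lra.
Qed.

(** Raise the exponent to 34/35, then lower [k] to 23/17; both moves increase the denominator. *)
Lemma M_lt_sinc_q_le (k q : R) :
  23 / 17 <= k <= 3 -> admissible k q -> q <= 34 / 35 ->
  forall x, 0 < x < PI / 2 -> M k (cos x) q < sin x / x.
Proof.
intros Hk Hadm Hq.
apply (M_lt_sinc_of_Mden_le _ _ (23 / 17) (34 / 35) Hadm Mden_23_17_lt); intros t Ht.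
apply Rle_trans with (Mden k (34 / 35) t).
- apply Mden_le_q; lra.
- apply Mden_ge_k; lra.
Qed.

Lemma M_lt_sinc_small_k (k q : R) :
  k <= 23 / 17 -> admissible k q -> q <= qc k ->
  forall x, 0 < x < PI / 2 -> M k (cos x) q < sin x / x.
Proof.
intros Hk Hadm Hq.
apply (M_lt_sinc_of_Mden_le _ _ (23 / 17) (34 / 35) Hadm Mden_23_17_lt); intros t Ht.
rewrite <- qc_23_17; apply Rle_trans with (Mden k (qc k) t).
- apply Mden_le_q; lra.
- apply Mden_qc_le; try lra; apply qc_increasing; lra.
Qed.

(** For [k > 3] the denominator decreases with [q], so the path lowers [q] to [qc k < 0] and then
    compares along the critical curve with the positive exponent 34/35. *)
Lemma M_lt_sinc_k_gt_3 (k q : R) :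
  3 < k -> admissible k q -> qc k <= q ->
  forall x, 0 < x < PI / 2 -> M k (cos x) q < sin x / x.
Proof.
intros Hk Hadm Hq.
apply (M_lt_sinc_of_Mden_le _ _ (23 / 17) (34 / 35) Hadm Mden_23_17_lt); intros t Ht.
rewrite <- qc_23_17; apply Rle_trans with (Mden k (qc k) t).
- apply Mden_ge_q; lra.
- apply Mden_qc_le; try lra.
  apply Rle_trans with 0; [ | rewrite qc_23_17; lra].
  assert (/ (5 * (3 - k)) < 0) by (apply Rinv_lt_0_compat; lra).
  unfold qc, Rdiv; lra.
Qed.

(** * Numerical bounds and assembly *)

(** The lower bound gives [29/20 <= PI^2/4 - 1]; the upper one keeps the ranges of [k] that end at
    an expression in [PI] below 3. *)
Lemma PI_sq_bounds : 49 / 5 <= PI ^ 2 <= 11.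
Proof.
pose proof (PI_2_3_7_ineq 0) as H.
unfold PI_2_3_7_tg, tg_alt, Ratan_seq in H; simpl in H.
assert (3.135 <= PI <= 3.24) by lra.
simpl; nra.
Qed.

Theorem theorem5 :
  (* (i) *)
  (forall k, 3 < k -> forall q, admissible k q -> qc k <= q <= 0 ->
     forall x, 0 < x < PI/2 -> sin x / x > M k (cos x) q) /\
  (* (ii) *)
  (forall k, (35 * PI^2 - 140) / 136 <= k < 3 ->
     forall q1 q2, admissible k q1 -> admissible k q2 ->
     q2 >= qc k -> q1 <= 1 ->
     forall x, 0 < x < PI/2 -> dbl k q1 q2 x) /\
  (* (iii) *)
  (forall k, PI^2/4 - 1 <= k < (35 * PI^2 - 140) / 136 ->
     forall q1 q2, admissible k q1 -> admissible k q2 ->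
     q2 >= qc k -> (q1 <= 34/35 \/ (PI^2/4 - 1) / k <= q1 <= 1) ->
     forall x, 0 < x < PI/2 -> dbl k q1 q2 x) /\
  (* (iv) *)
  (forall k, 7/5 <= k < PI^2/4 - 1 ->
     forall q1 q2, admissible k q1 -> admissible k q2 ->
     q2 >= qc k -> q1 <= 34/35 ->
     forall x, 0 < x < PI/2 -> dbl k q1 q2 x) /\
  (* (v) *)
  (forall k, 23/17 <= k < 7/5 ->
     forall q1 q2, admissible k q1 -> admissible k q2 ->
     q2 >= 1 -> q1 <= 34/35 ->
     forall x, 0 < x < PI/2 -> dbl k q1 q2 x) /\
  (* (vi) *)
  (forall k, 0 <= k < 23/17 ->
     forall q1 q2, admissible k q1 -> admissible k q2 ->
     q2 >= 1 -> q1 <= qc k ->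
     forall x, 0 < x < PI/2 -> dbl k q1 q2 x) /\
  (* (vii) *)
  (forall k, k < 0 ->
     forall q1 q2, admissible k q1 -> admissible k q2 ->
     q2 >= 1 -> 0 <= q1 <= qc k ->
     forall x, 0 < x < PI/2 -> dbl k q1 q2 x).
Proof.
pose proof PI_sq_bounds as HPI.
repeat split; intros.
- apply M_lt_sinc_k_gt_3; trivial; lra.
- apply M_lt_sinc_k_ge; trivial; lra.
- apply sinc_lt_M_large_k; trivial; lra.
(* Both alternatives for [q1] give [q1 <= 1]. *)
- apply M_lt_sinc_k_ge; trivial; lra.
- apply sinc_lt_M_large_k; trivial; lra.
- apply M_lt_sinc_q_le; trivial; lra.
- apply sinc_lt_M_large_k; trivial; lra.
- apply M_lt_sinc_q_le; trivial; lra.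
- apply sinc_lt_M_small_k; trivial; lra.
- apply M_lt_sinc_small_k; trivial; lra.
- apply sinc_lt_M_small_k; trivial; lra.
- apply M_lt_sinc_small_k; trivial; lra.
- apply sinc_lt_M_small_k; trivial; lra.
Qed.
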